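(* Let $K$ be a ring and $a\in K$. The monogenic ring $\mathbb{Z}\langle a\rangle$ is finitely separable if and only if there exist integers $k,n,k_1,\dots,k_{n-1}$ with $n>0$ and $k>0$ square-free (i.e. $k=1$ or $k$ is a product of distinct primes) such that $$k\,(a^{n}+k_1a^{n-1}+k_2a^{n-2}+\dots+k_{n-1}a)=0 .$$
   Context: Rings are associative and not necessarily unital or commutative. A ring $K$ is finitely separable if for every element $a\in K$ and every subring $A\subseteq K$ with $a\notin A$ there exist a finite ring $F$ and a ring homomorphism $\varphi:K\to F$ with $\varphi(a)\notin\varphi(A)$. For $a\in K$, $\mathbb{Z}\langle a\rangle$ denotes the subring generated by $a$, i.e. $\{g(a): g\in\mathbb{Z}[x],\ g(0)=0\}$; such rings are called monogenic. *)

(* Defs.v *)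
From HB Require Import structures.
From mathcomp Require Import all_boot all_order all_algebra.
Set Implicit Arguments. Unset Strict Implicit. Unset Printing Implicit Defensive.
Import GRing.Theory.
Local Open Scope ring_scope.

Definition is_ring (V : zmodType) (mul : V -> V -> V) : Prop :=
  associative mul /\ left_distributive mul +%R /\ right_distributive mul +%R.

(* apow mul a m = a^m for m >= 1 (a^1 = a, a^(m+1) = a * a^m). *)
Definition apow (V : zmodType) (mul : V -> V -> V) (a : V) (m : nat) : V :=
  iter m.-1 (mul a) a.

Definition Zgen (V : zmodType) (mul : V -> V -> V) (a : V) (x : V) : Prop :=
  exists (m : nat) (c : nat -> int),
    x = \sum_(1 <= i < m) apow mul a i *~ c i.

Definition is_subring_in (V : zmodType) (mul : V -> V -> V)
    (S A : V -> Prop) : Prop :=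
  (forall x, A x -> S x) /\ A 0 /\
  (forall x y, A x -> A y -> A (x - y)) /\
  (forall x y, A x -> A y -> A (mul x y)).

(* A subring S of a ring (V, mul), viewed as a ring in its own right, is
   finitely separable: for every b in S and every subring A of S with
   b \notin A there are a finite ring F and a ring homomorphism phi : S -> F
   with phi b \notin phi(A).  A map S -> F is represented by a function
   V -> F whose values outside S are irrelevant. *)
Definition fin_separable_sub (V : zmodType) (mul : V -> V -> V)
    (S : V -> Prop) : Prop :=
  forall (b : V) (A : V -> Prop),
    S b -> is_subring_in mul S A -> ~ A b ->
    exists (F : finZmodType) (mulF : F -> F -> F) (phi : V -> F),
      is_ring mulF /\
      (forall x y, S x -> S y ->
         phi (x + y) = phi x + phi y /\ phi (mul x y) = mulF (phi x) (phi y)) /\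
      ~ (exists y, A y /\ phi y = phi b).

Definition squarefree (k : nat) : Prop :=
  exists s : seq nat, uniq s /\ all prime s /\ k = \prod_(p <- s) p.

(* Main.v *)
(* The map u |-> (X u)(a) identifies Z<a> with Z[X]/I for an ideal I of Z[X],
   the product of Z<a> becoming (u, v) |-> X u v.

   If k p lies in I with p monic and k square-free, let A be a subring and b not
   in A.  As k Z[X] + A over A is a finitely generated group, b stays outside
   A + m Z[X] for some m > 0, and a minimal such m is a prime power q^e; then A
   may be assumed to contain q^e and q p.  If A vanishes modulo q, a multiple
   X^L p with L large finishes.  Otherwise A is stable under a multiplication by
   some f nonconstant modulo q, and one enlarges A to an f-stable subgroup that
   avoids b and has an element in every class of degrees modulo deg f.  It has
   finite index, hence contains the finite-index ideal (q^e, f^i - f^j).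

   Conversely, let P be the primitive part of an element of least degree in I, so
   that I is contained in (P).  If a prime q divides the leading coefficient
   c = q^s c' of P, the subring A = Z<c a> modulo P is not separable: in a finite
   quotient, q^K (c' a)^j lies in the image of A for a fixed K and all j, because
   the q-primary part satisfies an equation of degree < deg P with invertible
   leading coefficient, while c is invertible away from the q-part of c.  For j
   large this element is not in A.  Hence P is monic up to sign and k P' is in I
   for some monic P'.  If the least such k is divisible by q^2, then
   w = (k/q) P'(a) generates a null ideal, isomorphic to F_q[X] as a module; all its subgroups
   are subrings, and the kernel of a linear form whose sequence of values on the
   X^i is not ultimately periodic cannot be separated. *)

Require Import Defs.
From HB Require Import structures.
From mathcomp Require Import all_boot all_order all_algebra.
From mathcomp Require Import boolp zify ring.
Set Implicit Arguments. Unset Strict Implicit. Unset Printing Implicit Defensive.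
Import Order.TTheory GRing.Theory Num.Theory.
Local Open Scope ring_scope.

(** * Subgroups, ideals and reduction modulo a prime *)

Definition subgroup {W : zmodType} (A : W -> Prop) : Prop :=
  A 0 /\ forall u v, A u -> A v -> A (u - v).

Definition ideal (J : {poly int} -> Prop) : Prop :=
  subgroup J /\ forall u v, J v -> J (u * v).

(** Each fibre of [cl] must lie inside one coset of [A], but [cl] may split a coset; this spares a
    choice of canonical representatives. *)
Definition fin_index {W : zmodType} (A : W -> Prop) : Prop :=
  exists (T : finType) (cl : W -> T), forall u v, cl u = cl v -> A (u - v).

Definition setsum {W : zmodType} (A B : W -> Prop) (u : W) : Prop :=
  exists v, A v /\ B (u - v).

Section Subgroups.
Context {W : zmodType} {A : W -> Prop} (sA : subgroup A).

Lemma sub0 : A 0. Proof. exact: sA.1. Qed.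

Lemma subB u v : A u -> A v -> A (u - v). Proof. exact: sA.2. Qed.

Lemma subN u : A u -> A (- u).
Proof. by move=> Au; rewrite -sub0r; apply: subB => //; apply: sub0. Qed.

Lemma subD u v : A u -> A v -> A (u + v).
Proof. by move=> Au Av; rewrite -[v]opprK; apply: subB => //; apply: subN. Qed.

Lemma subMn u n : A u -> A (u *+ n).
Proof.
move=> Au; elim: n => [|n IH]; first by rewrite mulr0n; apply: sub0.
by rewrite mulrS; apply: subD.
Qed.

Lemma subMz u (c : int) : A u -> A (u *~ c).
Proof.
move=> Au; case: c => n; first by rewrite -pmulrn; apply: subMn.
by rewrite NegzE mulrNz; apply: subN; rewrite -pmulrn; apply: subMn.
Qed.

Lemma sub_sum (I : eqType) (r : seq I) (F : I -> W) :
  (forall i, i \in r -> A (F i)) -> A (\sum_(i <- r) F i).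
Proof.
elim: r => [|i r IH] H; first by rewrite big_nil; apply: sub0.
rewrite big_cons; apply: subD; first by apply: H; rewrite mem_head.
by apply: IH => j jr; apply: H; rewrite inE jr orbT.
Qed.

Lemma sub_diff u v : A v -> A (u - v) -> A u.
Proof. by move=> Av Auv; rewrite -(subrK v u); apply: subD. Qed.

End Subgroups.

Lemma setsum_subgroup {W : zmodType} {A B : W -> Prop} :
  subgroup A -> subgroup B -> subgroup (setsum A B).
Proof.
move=> sA sB; split; first by exists 0; rewrite subr0; split; [exact: sub0 | exact: sub0].
move=> u v [u' [Au Bu]] [v' [Av Bv]]; exists (u' - v'); split; first exact: subB.
by rewrite opprD addrACA -opprD; apply: subB.
Qed.

Lemma setsuml {W : zmodType} {A B : W -> Prop} (u : W) :
  subgroup B -> A u -> setsum A B u.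
Proof. by move=> sB Au; exists u; rewrite subrr; split => //; exact: sub0. Qed.

Lemma setsumr {W : zmodType} {A B : W -> Prop} (u : W) :
  subgroup A -> B u -> setsum A B u.
Proof. by move=> sA Bu; exists 0; rewrite subr0; split => //; exact: sub0. Qed.

Lemma setsum_ideal {I J : {poly int} -> Prop} :
  ideal I -> ideal J -> ideal (setsum I J).
Proof.
move=> [sI iI] [sJ iJ]; split; first exact: setsum_subgroup.
move=> u v [w [Iw Jw]]; exists (u * w); split; first exact: iI.
by rewrite -mulrBr; apply: iJ.
Qed.

Lemma subMR {A : {poly int} -> Prop} (sA : subgroup A) (c : int) u :
  A u -> A (c%:~R * u).
Proof. by rewrite mulrzl; apply: subMz. Qed.

Lemma subMRn {A : {poly int} -> Prop} (sA : subgroup A) n u :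
  A u -> A (n%:R * u).
Proof. by rewrite mulr_natl; apply: subMn. Qed.

Lemma dvd_ideal (m : nat) : ideal (fun u => exists v, u = m%:R * v).
Proof.
split; first split.
- by exists 0; rewrite mulr0.
- by move=> _ _ [u ->] [v ->]; exists (u - v); rewrite mulrBr.
by move=> u _ [v ->]; exists (u * v); ring.
Qed.

Lemma principal_ideal (p : {poly int}) : ideal (fun u => exists v, u = p * v).
Proof.
split; first split.
- by exists 0; rewrite mulr0.
- by move=> _ _ [u ->] [v ->]; exists (u - v); rewrite mulrBr.
by move=> u _ [v ->]; exists (u * v); ring.
Qed.

Lemma setsum_star {A J : {poly int} -> Prop} :
  ideal J -> (forall u v, A u -> A v -> A ('X * u * v)) ->
  forall u v, setsum A J u -> setsum A J v -> setsum A J ('X * u * v).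
Proof.
move=> [sJ iJ] hA u v [u' [Au Ju]] [v' [Av Jv]].
exists ('X * u' * v'); split; first exact: hA.
rewrite (_ : _ - _ = 'X * v * (u - u') + 'X * u' * (v - v')); last by ring.
by apply: (subD sJ); apply: iJ.
Qed.

Lemma not_injective_nat (T : finType) (g : nat -> T) :
  exists i j, (i < j)%N /\ g i = g j.
Proof.
have /injectivePn [i [j ij gij]] : ~~ injectiveb (fun i : 'I_(#|T|.+1) => g i).
  apply/injectiveP => /leq_card; by rewrite card_ord ltnn.
have := ij; rewrite -(inj_eq val_inj) neq_ltn => /orP [] lt.
  by exists i, j.
by exists j, i.
Qed.

Lemma dvd_coefP (m : nat) (u : {poly int}) :
  (forall i, (m %| u`_i)%Z) -> exists v, u = m%:R * v.
Proof.
move=> u0; have /polyOver_dvdzP [v ->] : u \is a polyOver (dvdz m).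
  exact/polyOverP.
by exists v; rewrite -mul_polyC -[Posz m]natz rmorph_nat.
Qed.

(** * Reduction modulo a prime and division with remainder *)

Notation red q := (map_poly (intr : int -> 'F_q)).

Section Reduction.
Context (q : nat) (q_pr : prime q).

Lemma red_eq0 u : red q u = 0 -> exists v, u = q%:R * v.
Proof.
move=> u0; apply: dvd_coefP => i; rewrite (dvdz_pcharf (pchar_Fp q_pr)).
by rewrite -coef_map /= u0 coef0.
Qed.

Lemma redn (c : nat) : red q c%:R = c%:R.
Proof. by rewrite rmorph_nat. Qed.

Lemma red_q : red q q%:R = 0.
Proof. by rewrite redn -(rmorph_nat polyC) pchar_Fp_0. Qed.

Lemma red_qM u : red q (q%:R * u) = 0.
Proof. by rewrite rmorphM /= red_q mul0r. Qed.

Lemma size_red u : (size (red q u) <= size u)%N.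
Proof. exact: size_poly. Qed.

Lemma lift_Fp (x : 'F_q) : exists c : int, c%:~R = x.
Proof. by exists (x : nat)%:Z; rewrite -pmulrn natr_Zp. Qed.

(** With [w] a lift of the inverse leading coefficient modulo [q], the polynomial [w g] is congruent
    to a monic one of degree [d]; the term [q e] removes the coefficients above [d] and corrects the
    leading one to 1. *)
Lemma monic_lift g : red q g != 0 -> exists (w : int) (e : {poly int}),
  let P := w%:~R * g - q%:R * e in P \is monic /\ size P = size (red q g).
Proof.
move=> g0; set d := (size (red q g)).-1.
have dE : size (red q g) = d.+1 by rewrite prednK // size_poly_gt0.
have [w wE] := lift_Fp (lead_coef (red q g))^-1.
pose h := w%:~R * g; pose P := 'X^d + take_poly d h.
have rh : red q h = (lead_coef (red q g))^-1 *: red q g.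
  by rewrite rmorphM /= rmorph_int -wE -mul_polyC -(rmorph_int polyC).
have szP : size P = d.+1.
  by rewrite size_polyDl ?size_polyXn // ltnS size_take_poly.
have mP : P \is monic.
  by rewrite monicE lead_coefE szP coefD coefXn coef_take_poly eqxx ltnn addr0.
have [e eE] : exists e, h - P = q%:R * e.
  apply: red_eq0; apply/eqP; rewrite rmorphB subr_eq0; apply/eqP/polyP => i.
  rewrite rmorphD /= coefD map_polyXn coefXn [in RHS]coef_map /= coef_take_poly.
  have [id|id|->] := ltngtP i d.
  - by rewrite add0r coef_map.
  - by rewrite add0r rh coefZ [_`_i]nth_default ?mulr0 // dE.
  - by rewrite addr0 rh coefZ -lead_coefE mulVf // lead_coef_eq0.
by exists w, e => /=; rewrite -/h -eE opprB addrC subrK dE.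
Qed.

(** Euclidean division by the monic lift [P = w g - q e]. Modulo [J] the part [w g] of [P] vanishes,
    so the quotient contributes only a multiple of [q]. *)
Lemma mod_reduce1 (J : {poly int} -> Prop) g : ideal J -> J g -> red q g != 0 ->
  forall u, exists r u' : {poly int}, (size r <= (size (red q g)).-1)%N /\
    J (u - r - q%:R * u').
Proof.
move=> [sJ iJ] Jg g0 u; have [w [e /=]] := monic_lift g0.
set P := (_ - _) => -[mP szP]; exists (u %% P), (- e * (u %/ P)); split.
  by rewrite -ltnS prednK ?size_poly_gt0 // -szP ltn_modp monic_neq0.
rewrite {1}(Pdiv.IdomainMonic.divp_eq mP u).
rewrite (_ : _ - _ = (u %/ P) * w%:~R * g); first exact: iJ.
by rewrite {2}/P; ring.
Qed.

End Reduction.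

(** Reducing the cofactor of [q ^ m] again gains one power of [q] per round, while the size bound on
    the remainder stays the same. *)
Lemma mod_reduce (q : nat) (J : {poly int} -> Prop) g :
  prime q -> ideal J -> J g -> red q g != 0 ->
  forall m u, exists r u' : {poly int}, (size r <= (size (red q g)).-1)%N /\
    J (u - r - (q ^ m)%:R * u').
Proof.
move=> q_pr iJ Jg g0 m u; elim: m => [|m [r [u' [sr Ju]]]].
  by exists 0, u; rewrite size_poly0; split=> //; rewrite mul1r subr0 subrr; exact: sub0 iJ.1.
have [r1 [u1 [sr1 Ju1]]] := mod_reduce1 q_pr iJ Jg g0 u'.
exists (r + (q ^ m)%:R * r1), u1; split.
  rewrite (leq_trans (size_polyD _ _)) // geq_max sr mulr_natl -scaler_nat.
  exact: leq_trans (size_scale_leq _ _) sr1.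
rewrite (_ : _ - _ = (u - r - (q ^ m)%:R * u') +
   (q ^ m)%:R * (u' - r1 - q%:R * u1)); last by rewrite expnSr; ring.
by apply: (subD iJ.1) => //; apply: iJ.2.
Qed.

(** * Finite index and finite quotients *)

Lemma fin_index_small (A : {poly int} -> Prop) (m n : nat) : subgroup A ->
  (0 < m)%N -> (forall u, A (m%:R * u)) ->
  (forall u, exists r : {poly int}, (size r <= n)%N /\ A (u - r)) -> fin_index A.
Proof.
move=> sA m0 Am /choice [f fP].
(* The class of [u] records the coefficients modulo [m] of its short representative; the bound
   [m.+1] provides the nonempty ordinal type that [inord] requires. *)
exists {ffun 'I_n -> 'I_m.+1}, (fun u => [ffun i : 'I_n => inord `|(f u)`_i %% m|%Z%N]).
move=> u v /ffunP fuv.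
have [w wE] : exists w, f u - f v = m%:R * w.
  apply: dvd_coefP => i; rewrite coefB.
  have [lt|ge] := ltnP i n; last first.
    by rewrite !nth_default ?subrr ?dvdz0 // (leq_trans _ ge) //; apply: (fP _).1.
  have := fuv (Ordinal lt); rewrite !ffunE /= => /(congr1 val) /=.
  have mb (x : int) : (`|x %% m|%Z < m.+1)%N by have := @ltz_pmod x m; lia.
  rewrite !inordK // => e.
  have : ((f u)`_i = (f v)`_i %[mod m])%Z.
    have := @modz_ge0 (f u)`_i m; have := @modz_ge0 (f v)`_i m; lia.
  by move/eqP; rewrite eqz_mod_dvd.
rewrite (_ : u - v = (u - f u) - (v - f v) + (f u - f v)); last by ring.
apply: (subD sA); last by rewrite wE.
by apply: (subB sA); apply: (fP _).2.
Qed.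

Lemma ideal_fin_index (q m : nat) (J : {poly int} -> Prop) g :
  prime q -> ideal J -> J (q ^ m)%:R -> J g -> red q g != 0 -> fin_index J.
Proof.
move=> q_pr iJ Jq Jg g0.
have Jqm u : J ((q ^ m)%:R * u) by rewrite mulrC; apply: iJ.2.
apply: (@fin_index_small _ (q ^ m) (size (red q g)).-1); first exact: iJ.1.
- by rewrite expn_gt0 prime_gt0.
- exact: Jqm.
move=> u; have [r [u' [sr Ju]]] := mod_reduce q_pr iJ Jg g0 m u.
by exists r; split=> //; apply: sub_diff Ju; [exact: iJ.1 | exact: Jqm].
Qed.

Lemma fin_indexW {W : zmodType} (A B : W -> Prop) :
  (forall u, A u -> B u) -> fin_index A -> fin_index B.
Proof. by move=> AB [T [cl clP]]; exists T, cl => u v /clP /AB. Qed.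

Lemma fin_index_powers (J : {poly int} -> Prop) (x : {poly int}) :
  fin_index J -> exists i j, (i < j)%N /\ J (x ^+ i - x ^+ j).
Proof.
case=> T [cl clP]; have [i [j [ij e]]] := not_injective_nat (fun n => cl (x ^+ n)).
by exists i, j; split=> //; apply: clP.
Qed.

Lemma fin_index_natr (J : {poly int} -> Prop) : subgroup J ->
  fin_index J -> exists2 m, (0 < m)%N & J m%:R.
Proof.
move=> sJ [T [cl clP]]; have [i [j [ij e]]] := not_injective_nat (fun n => cl n%:R).
exists (j - i)%N; first by rewrite subn_gt0.
by rewrite natrB ?(ltnW ij) //; apply: clP.
Qed.

(** One element is chosen for each attained class. The representative [r u] is the first of these
    congruent to [u] modulo [A], and the quotient is the finite type of fixed points of [r]. *)
Lemma quotient_exists {W : zmodType} (A : W -> Prop) :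
  subgroup A -> fin_index A ->
  exists (F : finZmodType) (pi : W -> F),
    [/\ forall u v, pi (u + v) = pi u + pi v,
        forall x, exists u, pi u = x &
        forall u, pi u = 0 <-> A u].
Proof.
move=> sA [T [cl clP]].
pose w (t : T) : W := if pselect (exists u, cl u = t) is left h then projT1 (cid h) else 0.
have wP u : A (u - w (cl u)).
  apply: clP; rewrite /w; case: pselect => [h|[]]; last by exists u.
  by case: (cid h).
pose s := [seq w t | t <- enum T].
pose r u := nth 0 s (find (fun v => `[< A (u - v) >]) s).
have has_s u : has (fun v => `[< A (u - v) >]) s.
  apply/hasP; exists (w (cl u)); first by apply: map_f; rewrite mem_enum.
  exact/asboolP.
have rP u : A (u - r u) by apply/asboolP; apply: (nth_find 0 (has_s u)).
have r_mem u : r u \in s by apply: mem_nth; rewrite -has_find.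
have rE u v : A (u - v) -> r u = r v.
  move=> Auv; rewrite /r; congr (nth 0 s _); apply: eq_find => x.
  apply/asboolP/asboolP => H.
    rewrite (_ : v - x = - (u - v) + (u - x)); first by apply: (subD sA) => //; apply: (subN sA).
    by rewrite opprB addrA subrK.
  rewrite (_ : u - x = (u - v) + (v - x)); first by apply: (subD sA).
  by rewrite addrA subrK.
have rr u : r (r u) = r u.
  by apply: rE; rewrite -opprB; apply: (subN sA).
pose Q := {x : seq_sub s | r (val x) == val x}.
have Qr u : r (val (SeqSub (r_mem u))) == val (SeqSub (r_mem u)) by rewrite /= rr.
pose pi u : Q := exist _ (SeqSub (r_mem u)) (Qr u).
have piE u v : pi u = pi v <-> A (u - v).
  split=> [/(congr1 val)/(congr1 val)/= e|/rE e]; last by do 2![apply: val_inj => /=].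
  rewrite (_ : u - v = (u - r u) - (v - r v)); first exact: (subB sA).
  by rewrite e opprB addrA subrK.
pose rp (x : Q) : W := val (val x).
have rpK x : pi (rp x) = x by do 2![apply: val_inj => /=]; apply/eqP/(valP x).
have pirp u : A (rp (pi u) - u) by apply/piE; rewrite rpK.
pose add x y := pi (rp x + rp y).
pose opp x := pi (- rp x).
have addE u v : add (pi u) (pi v) = pi (u + v).
  by apply/piE; rewrite opprD addrACA; apply: (subD sA).
have oppE u : opp (pi u) = pi (- u).
  by apply/piE; rewrite -opprD; apply: (subN sA).
have addA : associative add.
  by move=> x y z; rewrite -[x]rpK -[y]rpK -[z]rpK !addE addrA.
have addC : commutative add.
  by move=> x y; rewrite -[x]rpK -[y]rpK !addE addrC.
have add0 : left_id (pi 0) add.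
  by move=> x; rewrite -[x]rpK !addE add0r.
have addN : left_inverse (pi 0) opp add.
  by move=> x; rewrite -[x]rpK oppE addE addNr.
pose zm := GRing.isZmodule.Build Q addA addC add0 addN.
pose F : finZmodType := HB.pack Q zm.
exists F, pi; split.
- by move=> u v; rewrite -addE.
- by move=> x; exists (rp x); apply: rpK.
- by move=> u; rewrite -[u in A u]subr0; apply: piE.
Qed.

(** * Monogenic rings as quotients of Z[X] *)

(** Finite separability of [Z[X]/I] for the product [X u v]: [A] is the full preimage of a subring,
    and an ideal [J] of finite index replaces a homomorphism to a finite ring. *)
Definition poly_separable (I : {poly int} -> Prop) : Prop :=
  forall (A : {poly int} -> Prop) (b : {poly int}),
    subgroup A -> (forall u, I u -> A u) ->
    (forall u v, A u -> A v -> A ('X * u * v)) -> ~ A b ->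
    exists J, [/\ ideal J, fin_index J & ~ setsum A J b].

Section Evaluation.
Context (V : zmodType) (mul : V -> V -> V) (HK : is_ring mul) (a : V).

(* psi u is (X u)(a): the shift makes psi map Z[X] onto Z<a>. *)
Definition psi (u : {poly int}) : V :=
  \sum_(i < size u) apow mul a i.+1 *~ u`_i.

Lemma psiE n (u : {poly int}) : (size u <= n)%N ->
  psi u = \sum_(i < n) apow mul a i.+1 *~ u`_i.
Proof.
move=> un; rewrite /psi (big_ord_widen n (fun i => apow mul a i.+1 *~ u`_i) un).
rewrite big_mkcond; apply: eq_bigr => i _; case: ltnP => // le.
by rewrite nth_default // mulr0z.
Qed.

Lemma psiB u v : psi (u - v) = psi u - psi v.
Proof.
pose n := maxn (size u) (size v).
have un : (size u <= n)%N by apply: leq_maxl.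
have vn : (size v <= n)%N by apply: leq_maxr.
have uvn : (size (u - v)%R <= n)%N.
  by rewrite (leq_trans (size_polyD _ _)) // size_polyN.
rewrite (psiE un) (psiE vn) (psiE uvn) -sumrB; apply: eq_bigr => i _.
by rewrite coefB mulrzBr.
Qed.

Lemma psi0 : psi 0 = 0.
Proof. by rewrite -[X in psi X](subrr 0) psiB subrr. Qed.

Lemma psiD u v : psi (u + v) = psi u + psi v.
Proof. by rewrite -[v in LHS]opprK -(sub0r v) !psiB psi0 sub0r opprK. Qed.

Lemma psiMn u n : psi (u *+ n) = psi u *+ n.
Proof. by elim: n => [|n IH]; rewrite ?mulr0n ?psi0 // !mulrS psiD IH. Qed.

Lemma psiMz u (c : int) : psi (u *~ c) = psi u *~ c.
Proof.
case: c => n; first by rewrite -!pmulrn psiMn.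
by rewrite NegzE !mulrNz -!pmulrn -(sub0r (u *+ _)) psiB psi0 psiMn sub0r.
Qed.

Lemma rmulDl x y z : mul (x + y) z = mul x z + mul y z.
Proof. exact: HK.2.1. Qed.

Lemma rmulDr x y z : mul x (y + z) = mul x y + mul x z.
Proof. exact: HK.2.2. Qed.

Lemma rmulA x y z : mul x (mul y z) = mul (mul x y) z.
Proof. exact: HK.1. Qed.

Lemma rmul0l z : mul 0 z = 0.
Proof. by apply: (addrI (mul 0 z)); rewrite -rmulDl !addr0. Qed.

Lemma rmul0r z : mul z 0 = 0.
Proof. by apply: (addrI (mul z 0)); rewrite -rmulDr !addr0. Qed.

Lemma rmulzl x y (c : int) : mul (x *~ c) y = mul x y *~ c.
Proof.
have mulnl n : mul (x *+ n) y = mul x y *+ n.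
  by elim: n => [|n IH]; rewrite ?mulr0n ?rmul0l // !mulrS rmulDl IH.
case: c => n; first by rewrite -!pmulrn.
rewrite NegzE !mulrNz -!pmulrn; apply: (addrI (mul (x *+ n.+1) y)).
by rewrite -rmulDl !subrr ?rmul0l // mulnl subrr.
Qed.

Lemma rmulzr x y (c : int) : mul y (x *~ c) = mul y x *~ c.
Proof.
have mulnr n : mul y (x *+ n) = mul y x *+ n.
  by elim: n => [|n IH]; rewrite ?mulr0n ?rmul0r // !mulrS rmulDr IH.
case: c => n; first by rewrite -!pmulrn.
rewrite NegzE !mulrNz -!pmulrn; apply: (addrI (mul y (x *+ n.+1))).
by rewrite -rmulDr !subrr ?rmul0r // mulnr subrr.
Qed.

Lemma psiC (c : int) : psi c%:P = a *~ c.
Proof. by rewrite (psiE (size_polyC_leq1 c)) big_ord1 coefC. Qed.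

Lemma psiMX u : psi (u * 'X) = mul a (psi u).
Proof.
have le : (size (u * 'X)%R <= (size u).+1)%N.
  by rewrite (leq_trans (size_polyMleq _ _)) // size_polyX addn2.
rewrite (psiE le) big_ord_recl coefMX mulr0z add0r /psi.
rewrite (big_morph (mul a) (rmulDr a) (rmul0r a)); apply: eq_bigr => i _.
by rewrite coefMX /= rmulzr.
Qed.

Lemma psiM u v : psi ('X * u * v) = mul (psi u) (psi v).
Proof.
elim/poly_ind: u => [|u c IH]; first by rewrite mulr0 GRing.mul0r psi0 rmul0l.
rewrite (_ : 'X * _ * v = ('X * u * v) * 'X + c%:P * (v * 'X)); last by ring.
rewrite !psiD !psiMX psiC IH rmulDl rmulzl rmulA; congr (_ + _).
rewrite (_ : c%:P * _ = (v * 'X) *~ c); last by rewrite -mulrzl -(rmorph_int polyC) intz.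
by rewrite psiMz psiMX.
Qed.

Lemma ker_ideal : ideal (fun u => psi u = 0).
Proof.
split; first by split; [exact: psi0 | move=> u v; rewrite psiB => -> ->; rewrite subrr].
move=> u v v0; elim/poly_ind: u => [|u c IH]; first by rewrite GRing.mul0r psi0.
have sI : subgroup (fun u => psi u = 0).
  by split; [exact: psi0 | move=> x y; rewrite psiB => -> ->; rewrite subrr].
rewrite mulrDl psiD -mulrA ['X * v]mulrC mulrA psiMX IH rmul0r add0r.
rewrite -[c]intz (rmorph_int polyC).
exact: (subMR sI).
Qed.

Lemma Zgen_psi x : Zgen mul a x <-> exists u, x = psi u.
Proof.
split=> [[m [c ->]]|[u ->]].
  exists (\poly_(i < m.-1) c i.+1); rewrite (psiE (size_poly _ _)).
  rewrite big_add1 big_mkord; apply: eq_bigr => i _.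
  by rewrite coef_poly ltn_ord.
exists (size u).+1, (fun i => u`_i.-1).
by rewrite big_add1 /= big_mkord.
Qed.

Lemma fin_separable_subE :
  fin_separable_sub mul (Zgen mul a) <-> poly_separable (fun u => psi u = 0).
Proof.
have iI := ker_ideal; split=> [sep A b|sep b A].
  move=> sA IA starA nAb.
  have AE u : (exists v, A v /\ psi u = psi v) -> A u.
    move=> [v [Av uv]]; apply: (sub_diff sA Av).
    by apply: IA; rewrite psiB uv subrr.
  pose A' x := exists u, A u /\ x = psi u.
  have [||nA'|F [mulF [phi [rF [hphi nphi]]]]] := sep (psi b) A'.
  - by apply/Zgen_psi; exists b.
  - split; [|split; [|split]].
    + by move=> x [u [_ ->]]; apply/Zgen_psi; exists u.
    + by exists 0; rewrite psi0; split=> //; apply: sub0 sA.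
    + by move=> _ _ [u [Au ->]] [v [Av ->]]; exists (u - v); rewrite psiB; split=> //; apply: (subB sA).
    + by move=> _ _ [u [Au ->]] [v [Av ->]]; exists ('X * u * v); rewrite psiM; split=> //; apply: starA.
  - by apply: nAb; apply: AE.
  have Zpsi u : Zgen mul a (psi u) by apply/Zgen_psi; exists u.
  have phiD u v : phi (psi (u + v)) = phi (psi u) + phi (psi v).
    by rewrite psiD (hphi _ _ _ _).1.
  have phiM u v : phi (psi ('X * u * v)) = mulF (phi (psi u)) (phi (psi v)).
    by rewrite psiM (hphi _ _ _ _).2.
  have phi0 : phi (psi 0) = 0.
    by apply: (addrI (phi (psi 0))); rewrite -phiD !addr0.
  have phiB u v : phi (psi (u - v)) = phi (psi u) - phi (psi v).
    by apply: (addIr (phi (psi v))); rewrite -phiD !subrK.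
  have mulF0 x : mulF x 0 = 0.
    by apply: (addrI (mulF x 0)); rewrite -rF.2.2 !addr0.
  have sJ : subgroup (fun u => phi (psi u) = 0).
    by split=> // u v; rewrite phiB => -> ->; rewrite subrr.
  exists (fun u => phi (psi u) = 0); split.
  - split=> // u v v0; elim/poly_ind: u => [|u c IH]; first by rewrite GRing.mul0r.
    rewrite mulrDl; apply: (subD sJ).
      (* Multiplication by [X] is the ring product with the class of 1, which is [a]; hence the
         kernel of [phi] is stable under all of [Z[X]]. *)
      by rewrite (_ : _ * v = 'X * 1 * (u * v)) ?phiM ?IH ?mulF0 //; ring.
    by rewrite -[c]intz (rmorph_int polyC); apply: (subMR sJ).
  - by exists F, (fun u => phi (psi u)) => u v e; rewrite phiB e subrr.
  - case=> y [Ay]; rewrite phiB => /subr0_eq e; apply: nphi.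
    by exists (psi y); split=> //; exists y.
move=> /Zgen_psi [b0 bE] [AS [A0 [AB AM]]] nAb.
pose A' u := A (psi u).
have sA' : subgroup A' by split=> [|u v]; rewrite /A' ?psi0 ?psiB //; apply: AB.
have [|||J [iJ fJ nJ]] := sep A' b0 sA'.
- by move=> u; rewrite /A' => ->.
- by move=> u v; rewrite /A' psiM; apply: AM.
- by rewrite /A' -bE.
(* A map on [Z<a>] must kill the kernel of [psi]. Adding this kernel to [J] still separates [b],
   because [A'] contains it. *)
pose J' := setsum (fun u => psi u = 0) J.
have iJ' : ideal J' by apply: setsum_ideal.
have [|F [pi [piD pis pi0]]] := @quotient_exists _ J' iJ'.1.
  by apply: fin_indexW fJ => u; apply: setsumr; exact: iI.1.
have piB u v : pi (u - v) = pi u - pi v.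
  by apply: (addIr (pi v)); rewrite -piD !subrK.
have piE u v : pi u = pi v <-> J' (u - v).
  by rewrite -pi0 piB; split=> [->|/subr0_eq //]; rewrite subrr.
have [rp rpK] := choice pis.
pose mulF x y := pi ('X * rp x * rp y).
have mulFE u v : mulF (pi u) (pi v) = pi ('X * u * v).
  apply/piE; rewrite (_ : _ - _ = 'X * rp (pi v) * (rp (pi u) - u) + 'X * u * (rp (pi v) - v)); last by ring.
  by apply: (subD iJ'.1); apply: iJ'.2; apply/piE; rewrite rpK.
(* A chosen preimage under [psi]; the default 0 occurs only outside [Z<a>], where the values of the
   map are irrelevant. *)
pose up (x : V) : {poly int} :=
  if pselect (exists u, x = psi u) is left h then projT1 (cid h) else 0.
have upE u : pi (up (psi u)) = pi u.
  apply/piE; apply: setsuml; first exact: iJ.1.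
  rewrite psiB /up; case: pselect => [h|[]]; last by exists u.
  by case: (cid h) => v /= <-; rewrite subrr.
exists F, mulF, (fun x => pi (up x)); split; [split; [|split]|split].
- by move=> x y z; rewrite -[x]rpK -[y]rpK -[z]rpK !mulFE; congr pi; ring.
- by move=> x y z; rewrite -[x]rpK -[y]rpK -[z]rpK -piD !mulFE -piD; congr pi; ring.
- by move=> x y z; rewrite -[x]rpK -[y]rpK -[z]rpK -piD !mulFE -piD; congr pi; ring.
- move=> x y /Zgen_psi [u ->] /Zgen_psi [v ->].
  by rewrite -psiD -psiM !upE piD mulFE.
case=> y [Ay]; have /Zgen_psi [v vE] := AS y Ay.
rewrite bE vE !upE => /esym /piE [w [w0 Jw]]; apply: nJ; exists (v + w); split.
  by rewrite /A' psiD w0 addr0 -vE.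
by rewrite opprD addrA.
Qed.

(** The shift in [psi] sends the leading term, of degree [size p - 1], to the power [size p] of [a],
    so the exponent [n] of the relation is a size. *)
Lemma psi_monicE p : p \is monic ->
  psi p = apow mul a (size p) +
    \sum_(1 <= j < size p) apow mul a (size p - j) *~ p`_((size p).-1 - j).
Proof.
move=> mp; have sp : (0 < size p)%N by rewrite size_poly_gt0 monic_neq0.
have := monicP mp; rewrite lead_coefE /psi; case: (size p) sp => // n _ /= pn.
rewrite big_ord_recr /= pn addrC; congr (_ + _).
rewrite big_add1 /= big_mkord [RHS](reindex_inj rev_ord_inj) /=.
apply: eq_bigr => i _; have lin := ltn_ord i.
by congr (apow _ _ _ *~ p`_ _); lia.
Qed.

Lemma psi_monic (n : nat) (kc : nat -> int) : (0 < n)%N ->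
  exists2 p, p \is monic &
    psi p = apow mul a n + \sum_(1 <= j < n) apow mul a (n - j) *~ kc j.
Proof.
case: n => // n _; pose p : {poly int} := 'X^n + \poly_(i < n) kc (n - i)%N.
have sp : size p = n.+1.
  by rewrite size_polyDl ?size_polyXn // ltnS size_poly.
have mp : p \is monic.
  by rewrite monicE lead_coefE sp coefD coefXn coef_poly eqxx ltnn addr0.
exists p => //; rewrite psi_monicE // sp; congr (_ + _).
apply: eq_big_nat => j /andP [j1 jn].
have lin : (n - j < n)%N by lia.
rewrite coefD coefXn coef_poly lin (ltn_eqF lin) add0r.
by congr (_ *~ kc _); lia.
Qed.

End Evaluation.

(** * Sufficiency *)

Lemma size_leq_pred (R : nzRingType) (p : {poly R}) n :
  (size p <= n.+1)%N -> p`_n = 0 -> (size p <= n)%N.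
Proof.
move=> sp pn; apply/leq_sizeP => j; rewrite leq_eqVlt => /predU1P [<- //|lt].
by rewrite nth_default // (leq_trans sp).
Qed.

Lemma size_natM (u : {poly int}) n : (size (n%:R * u)%R <= size u)%N.
Proof. by rewrite mulr_natl -scaler_nat size_scale_leq. Qed.

Lemma coef_natM (u : {poly int}) n i : (n%:R * u)`_i = n%:R * u`_i.
Proof. by rewrite !mulr_natl coefMn. Qed.

Lemma size_intM (u : {poly int}) (c : int) : (size (c%:~R * u)%R <= size u)%N.
Proof. by rewrite -(rmorph_int polyC) mul_polyC size_scale_leq. Qed.

Lemma coef_intM (u : {poly int}) (c : int) i : (c%:~R * u)`_i = c * u`_i.
Proof. by rewrite -(rmorph_int polyC) coefCM intz. Qed.

Lemma size_subr (u v : {poly int}) n :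
  (size u <= n)%N -> (size v <= n)%N -> (size (u - v)%R <= n)%N.
Proof.
by move=> su sv; rewrite (leq_trans (size_polyD _ _)) // size_polyN geq_max su.
Qed.

(** Residual finiteness of a finitely generated abelian group, by induction on the size bound: [h]
    in [H] with the smallest nonzero top coefficient plays the part of a pivot. *)
Lemma subgroup_residual n (H : {poly int} -> Prop) : subgroup H ->
  forall u : {poly int}, (size u <= n)%N -> ~ H u ->
  exists2 m, (0 < m)%N &
    forall v : {poly int}, (size v <= n)%N -> ~ H (u - m%:R * v).
Proof.
move=> sH; elim: n => [|n IH] u su nHu.
  by case: nHu; move: su; rewrite leqn0 size_poly_eq0 => /eqP ->; apply: sub0 sH.
pose P m := `[< exists h : {poly int}, [/\ (size h <= n.+1)%N, H h & `|h`_n| = m.+1%:Z] >].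
have suv m (v : {poly int}) : (size v <= n.+1)%N -> (size (u - m%:R * v)%R <= n.+1)%N.
  by move=> sv; rewrite size_subr // (leq_trans (size_natM _ _)).
have [exP|nP] := pselect (exists m, P m); last first.
  have top0 (h : {poly int}) : (size h <= n.+1)%N -> H h -> h`_n = 0.
    move=> sh Hh; apply/eqP; apply: contra_notT nP => h0.
    exists (absz h`_n).-1. apply/asboolP. by exists h; split=> //; lia.
  have [un|un] := eqVneq u`_n 0.
    have [m m0 hm] := IH u (size_leq_pred su un) nHu; exists m => // v sv Hv.
    apply: (hm v) => //; apply: (size_leq_pred sv).
    have /eqP := top0 _ (suv m v sv) Hv; rewrite coefB coef_natM un sub0r oppr_eq0 mulf_eq0 natz.
    by case: m m0 {hm Hv} => //= m _ /eqP.
  (* All top coefficients in [H] vanish here, so membership would make the nonzero [u_n] a multiple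
     of an integer larger than its absolute value. *)
  exists (absz u`_n).+1 => // v sv Hv.
  have := top0 _ (suv _ v sv) Hv; rewrite coefB coef_natM.
  rewrite natz; have [->|v0] := eqVneq v`_n 0; first by rewrite mulr0 subr0; move/eqP: un.
  move/subr0_eq/(congr1 absz); rewrite abszM absz_nat => e.
  have : (0 < absz (v`_n)%R)%N by rewrite absz_gt0.
  by move: (absz _) (absz _) e => x y; nia.
have [l /asboolP [h [sh Hh hl]] lmin] := ex_minnP exP.
have divl (g : {poly int}) : (size g <= n.+1)%N -> H g -> (h`_n %| g`_n)%Z.
  move=> sg Hg; apply/dvdz_mod0P; apply: contrapT => /eqP r0.
  pose g' := g - ((g`_n %/ h`_n)%Z)%:~R * h.
  have gr : g'`_n = (g`_n %% h`_n)%Z by rewrite coefB coef_intM.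
  have hn0 : h`_n != 0 by lia.
  have := lmin (absz g'`_n).-1; rewrite leqNgt => /(_ _)/negP; apply.
    apply/asboolP; exists g'; split; last by rewrite gr; lia.
      by rewrite size_subr // (leq_trans (size_intM _ _)).
    by apply: (subB sH) => //; apply: (subMR sH).
  by have := modz_ge0 g`_n hn0; have := ltz_mod g`_n hn0; rewrite gr; lia.
have hn0 : h`_n != 0 by lia.
have [ldiv|nldiv] := boolP (h`_n %| u`_n)%Z; last first.
  (* This modulus is the absolute value of the pivot [h_n], which divides every top coefficient in
     [H] and would therefore divide [u_n]. *)
  exists l.+1 => // v sv Hv; move/negP: nldiv; apply.
  have := divl _ (suv _ v sv) Hv.
  rewrite coefB coef_natM; apply: contraLR => nd; rewrite rpredBr //.
  by apply: dvdz_mulr; rewrite natz -hl normrEsign dvdz_mull.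
pose u' := u - ((u`_n %/ h`_n)%Z)%:~R * h.
have u'n : u'`_n = 0 by rewrite coefB coef_intM divzK // subrr.
have su' : (size u' <= n.+1)%N by rewrite size_subr // (leq_trans (size_intM _ _)).
have nHu' : ~ H u'.
  by move=> Hu'; apply: nHu; apply: (sub_diff sH) Hu'; apply: (subMR sH).
have [m m0 hm] := IH _ (size_leq_pred su' u'n) nHu'.
(* The extra factor equals [h_n] up to sign: [h_n v] differs by a multiple of [h] from [w], which
   has no top coefficient, and the induction hypothesis applies. *)
exists (m * l.+1)%N => [|v sv Hv]; first by rewrite muln_gt0 m0.
pose w := (h`_n)%:~R * v - (v`_n)%:~R * h.
have sw : (size w <= n)%N.
  apply: size_leq_pred; first by rewrite size_subr // (leq_trans (size_intM _ _)).
  by rewrite coefB !coef_intM mulrC subrr.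
have [s sE] : exists s : int, l.+1%:Z = s * h`_n.
  by exists ((-1) ^+ (h`_n < 0)%R); rewrite -hl normrEsign.
pose w' := s%:~R * w.
apply: (hm w'); first exact: leq_trans (size_intM _ _) sw.
rewrite (_ : u' - _ = (u - (m * l.+1)%:R * v) +
   (m%:R * s * v`_n - (u`_n %/ h`_n)%Z)%:~R * h).
  by apply: (subD sH) => //; apply: (subMR sH).
have -> : (m * l.+1)%:R = m%:R * s%:~R * (h`_n)%:~R :> {poly int}.
  by rewrite natrM -mulrA -intrM -sE.
by rewrite /u' /w' /w; ring.
Qed.

(** If every modulus failed, the modulus [k] would replace [b] by [k] times a remainder modulo [p].
    Such remainders have bounded size, so residual finiteness yields [m], and the modulus [k m]
    gives a contradiction. *)
Lemma subgroup_separated_mod (A : {poly int} -> Prop) (k : nat) (p b : {poly int}) :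
  subgroup A -> p \is monic -> (forall u, A (k%:R * p * u)) -> (0 < k)%N ->
  ~ A b ->
  exists2 m, (0 < m)%N & ~ setsum A (fun u => exists v, u = m%:R * v) b.
Proof.
move=> sA mp Ak k0 nAb; apply: contrapT => nex.
have dense m : (0 < m)%N -> exists v, A (b - m%:R * v).
  move=> m0; apply: contrapT => nv; apply: nex; exists m => // -[a [Aa [v bv]]].
  by apply: nv; exists v; rewrite -bv opprB addrC subrK.
have [u0 Au0] := dense k k0.
have modp u : A (k%:R * u - k%:R * (u %% p)).
  rewrite {1}(Pdiv.IdomainMonic.divp_eq mp u).
  by rewrite (_ : _ - _ = k%:R * p * (u %/ p)) //; ring.
have szp u : (size (u %% p)%R <= size p)%N by rewrite ltnW // ltn_modp monic_neq0.
pose H r := A (k%:R * r).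
have sH : subgroup H.
  split; first by rewrite /H mulr0; apply: sub0 sA.
  by move=> u v Hu Hv; rewrite /H mulrBr; apply: (subB sA).
have nHr : ~ H (u0 %% p).
  move=> Hr; apply: nAb; apply: (sub_diff sA) Au0.
  exact: (sub_diff sA Hr (modp u0)).
have [m m0 hm] := subgroup_residual sH (szp u0) nHr.
have [w Aw] : exists v, A (b - (k * m)%:R * v) by apply: dense; rewrite muln_gt0 k0.
apply: (hm (w %% p) (szp w)); rewrite /H.
rewrite (_ : k%:R * _ = (b - (k * m)%:R * w) - (b - k%:R * u0)
  - (k%:R * u0 - k%:R * (u0 %% p)) + m%:R * (k%:R * w - k%:R * (w %% p))); last by ring.
by apply: (subD sA); [do 2?[apply: (subB sA) => //] | apply: (subMRn sA)].
Qed.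

(** For a minimal modulus [m] that splits into coprime proper factors, [b] lies in [A] plus the
    multiples of either factor; a Bezout relation puts it in [A] plus the multiples of [m]. *)
Lemma separated_mod_prime_power (A : {poly int} -> Prop) (b : {poly int}) m :
  subgroup A -> (0 < m)%N ->
  ~ setsum A (fun u => exists v, u = m%:R * v) b ->
  exists q e, prime q /\ ~ setsum A (fun u => exists v, u = (q ^ e)%:R * v) b.
Proof.
move=> sA m0 nb.
pose P m := (0 < m)%N && `[< ~ setsum A (fun u => exists v, u = m%:R * v) b >].
have exP : exists m, P m by exists m; rewrite /P m0; apply/asboolP.
have [{}m /andP [{}m0 /asboolP {}nb] mmin] := ex_minnP exP.
have dense n : (0 < n < m)%N -> exists v, A (b - n%:R * v).
  case/andP=> n0 nm; apply: contrapT => nv.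
  have := mmin n; rewrite leqNgt nm => /(_ _)/negP; apply => //.
  rewrite /P n0; apply/asboolP => -[a [Aa [v bv]]].
  by apply: nv; exists v; rewrite -bv opprB addrC subrK.
have m1 : (1 < m)%N.
  case: m m0 nb {mmin dense} => [|[|m]] // _ []; exists 0; split; first exact: sub0 sA.
  by exists b; rewrite mul1r subr0.
have q_pr := pdiv_prime m1; exists (pdiv m), (logn (pdiv m) m); split=> //.
set q := pdiv m in q_pr *; set e := logn q m.
have [m' cop mE] := pfactor_coprime q_pr m0; rewrite -/e in mE.
have [m'1|m'1] := eqVneq m' 1%N; first by rewrite mE m'1 mul1n in nb.
have m'0 : (0 < m')%N by rewrite lt0n; apply: contraTneq m0; rewrite mE => ->.
have e0 : (0 < e)%N by rewrite logn_gt0 mem_primes q_pr m0 pdiv_dvd.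
have q1 := prime_gt1 q_pr.
have qe1 : (1 < q ^ e)%N by rewrite -(expn0 q) ltn_exp2l.
have [|v Av] := dense (q ^ e)%N.
  by rewrite mE ltn_Pmull ?(ltnW qe1) //=; lia.
have [|u Au] := dense m'; first by rewrite m'0 /= mE ltn_Pmulr.
have /coprimezP [[x y] /= xy] : coprimez m' (q ^ e)%N.
  by rewrite coprimezE /= coprimeXr // coprime_sym.
case: nb; exists (y%:~R * ((q ^ e)%:R * (b - m'%:R * u))
    + x%:~R * (m'%:R * (b - (q ^ e)%:R * v))); split.
  by apply: (subD sA); apply: (subMR sA); apply: (subMRn sA).
exists (y%:~R * u + x%:~R * v).
have -> : m%:R = m'%:R * (q ^ e)%:R :> {poly int} by rewrite mE natrM.
have : (x * m' + y * (q ^ e)%N)%:~R = 1 :> {poly int} by rewrite xy.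
rewrite rmorphD !rmorphM /= -!pmulrn => xy1.
have bE := mul1r b; rewrite -[in LHS]xy1 in bE.
by rewrite -[X in X - _ = _]bE; ring.
Qed.

(** * Subgroups stable under multiplication by a polynomial *)

Section Extension.
Context (q e d : nat) (q_pr : prime q) (p f : {poly int}).
Context (mp : p \is monic) (szf : size (red q f) = d.+1) (d0 : (0 < d)%N).

Definition stable (M : {poly int} -> Prop) : Prop :=
  [/\ subgroup M, forall u, M ((q ^ e)%:R * u), forall u, M (q%:R * p * u) &
      forall u, M u -> M (f * u)].

(** Multiplication by [f] adds [d] to the degree modulo [q]. A stable [M] that hits every class thus
    has elements of every sufficiently large degree modulo [q]. *)
Definition hits (M : {poly int} -> Prop) (r : nat) : Prop :=
  exists u, [/\ M u, red q u != 0 & size (red q u) = r %[mod d]].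

Lemma size_red_monic : size (red q p) = size p.
Proof. by rewrite size_map_poly_id0 // (monicP mp) rmorph1 oner_neq0. Qed.

(* Adjoin the multiples h(f) p X^w: since q p is in M, they only matter modulo q,
   and there their degrees lie in a class modulo d that M misses, so that no
   cancellation with elements of M can occur. *)
Lemma stable_extend M b r : stable M -> ~ M b -> ~ hits M r ->
  exists M', [/\ stable M', forall u, M u -> M' u, ~ M' b & hits M' r].
Proof.
move=> [sM Mq Mp Mf] nMb nhit.
(* As a multiple of [d], [D] leaves the class [r] unchanged; its size makes the subtraction in [w]
   exact and puts the degree of [v] above that of [b]. *)
have [D dle DE] : exists2 D, (size p + size b <= D)%N & (D = d * (size p + size b))%N.
  by exists (d * (size p + size b))%N; rewrite ?leq_pmull.
pose w := (D + r - size p)%N.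
pose v := p * 'X^w.
have sp0 : (0 < size p)%N by rewrite size_poly_gt0 monic_neq0.
have szv : size (red q v) = (D + r)%N.
  rewrite rmorphM /= map_polyXn size_mulXn ?size_red_monic; last first.
    by rewrite -size_poly_gt0 size_red_monic.
  by rewrite /w; lia.
have v0 : red q v != 0 by rewrite -size_poly_gt0 szv; lia.
have vb : (size b < size (red q v))%N by rewrite szv; lia.
pose N u := exists h, u = (h \Po f) * v.
have sN : subgroup N.
  split; first by exists 0; rewrite comp_poly0 mul0r.
  by move=> _ _ [g ->] [h ->]; exists (g - h); rewrite comp_polyB mulrBl.
exists (setsum M N); split.
- split; first exact: setsum_subgroup.
  + by move=> u; apply: setsuml.
  + by move=> u; apply: setsuml.
  move=> u [u' [Mu [h uE]]]; exists (f * u'); split; first exact: Mf.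
  exists ('X * h); rewrite -mulrBr uE comp_polyM comp_polyX; ring.
- by move=> u; apply: setsuml.
- case=> u [Mu [h uE]].
  have [h0|h0] := eqVneq (red q h) 0.
    have [h' hE] := red_eq0 q_pr h0; apply: nMb; apply: (sub_diff sM Mu).
    rewrite uE hE comp_polyM rmorph_nat.
    by rewrite (_ : _ * v = q%:R * p * ((h' \Po f) * 'X^w)) // /v; ring.
  apply: nhit; exists u.
  have f0 : red q f != 0 by rewrite -size_poly_gt0 szf.
  have szh : size (red q ((h \Po f) * v)) = (((size (red q h)).-1 * d) + size (red q v))%N.
    have c0 : red q h \Po red q f != 0 by rewrite comp_poly_eq0 // szf.
    rewrite rmorphM /= map_comp_poly size_mul //.
    by rewrite -[X in (X + _)%N]prednK ?size_poly_gt0 // size_comp_poly szf.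
  (* Since [b] is shorter than [v], it cannot affect the leading term of [u] modulo [q]. *)
  have szu : size (red q u) = size (red q ((h \Po f) * v)).
    rewrite -uE -[u in LHS](subKr b) rmorphB /= -size_polyN opprB size_polyDl // size_polyN.
    by rewrite uE szh (leq_ltn_trans (size_red _ _)) // (leq_trans vb) // leq_addl.
  split=> //; first by rewrite -size_poly_gt0 szu szh ltn_addl // (leq_ltn_trans _ vb).
  by rewrite szu szh szv DE addnA mulnC -mulnDr mulnC modnMDl.
- by exists v; split=> //; [apply: setsumr => //; exists 1; rewrite comp_polyC mul1r |
    rewrite szv DE mulnC modnMDl].
Qed.

Lemma stable_saturate M b : stable M -> ~ M b ->
  exists M', [/\ stable M', forall u, M u -> M' u, ~ M' b & forall r : 'I_d, hits M' r].
Proof.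
have [n] := ubnP #|[set r : 'I_d | `[< ~ hits M r >]]|.
elim: n M => // n IH M lt stM nMb.
have [all|/existsNP [r nr]] := pselect (forall r : 'I_d, hits M r); first by exists M.
have [M' [stM' MM' nM'b hr]] := stable_extend stM nMb nr.
have [|M'' [? M'M'' ? ?]] := IH M' _ stM' nM'b.
  rewrite ltnS in lt; apply: leq_trans lt; apply: proper_card; apply/properP; split.
    apply/subsetP => s; rewrite !inE => /asboolP ns; apply/asboolP => -[u [Mu u0 su]].
    by apply: ns; exists u; split=> //; apply: MM'.
  by exists r; rewrite inE; [apply/asboolP | apply/asboolP => nh; apply: nh].
by exists M''; split=> // u /MM' /M'M''.
Qed.

Lemma size_sub_lead (F : fieldType) (u v : {poly F}) : v != 0 -> size u = size v ->
  (size (u - (lead_coef u / lead_coef v)%:P * v)%R < size u)%N.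
Proof.
move=> v0 uv; have u0 : (0 < size u)%N by rewrite uv size_poly_gt0.
rewrite -[X in (_ < X)%N](prednK u0) ltnS; apply: size_leq_pred.
  rewrite (prednK u0) (leq_trans (size_polyD _ _)) // geq_max leqnn size_polyN.
  by rewrite mul_polyC uv size_scale_leq.
by rewrite coefB coefCM -lead_coefE uv -lead_coefE divfK ?subrr ?lead_coef_eq0.
Qed.

(** Elements [f^i g_r] of [M] cancel leading terms modulo [q] until the reduced size is at most [N].
    What remains is a short polynomial plus [q u'], and [q p] in [M] allows reducing [u'] modulo
    [p]. *)
Lemma stable_small M : stable M -> (forall r : 'I_d, hits M r) ->
  exists n, forall u, exists r : {poly int}, (size r <= n)%N /\ M (u - r).
Proof.
move=> [sM Mq Mp Mf] /choice [g gP].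
pose N := \max_(i < d) size (red q (g i)); exists (maxn N (size p)) => u.
have [s] := ubnP (size (red q u)); elim: s u => // s IH u lts.
have [leN|ltN] := leqP (size (red q u)) N.
  have [u' uE] : exists u', u - take_poly N u = q%:R * u'.
    apply: (red_eq0 q_pr); rewrite rmorphB; apply/polyP => i.
    rewrite coefB coef0 !coef_map /= coef_take_poly; case: ltnP => [_|le]; first by rewrite subrr.
    by rewrite rmorph0 subr0 -coef_map /= nth_default // (leq_trans leN).
  exists (take_poly N u + q%:R * (u' %% p)); split.
    have sm : (size (q%:R * (u' %% p))%R <= size p)%N.
      by rewrite (leq_trans (size_natM _ _)) // ltnW // ltn_modp monic_neq0.
    by rewrite (leq_trans (size_polyD _ _)) // geq_max !leq_max size_take_poly sm orbT.
  rewrite opprD addrA uE [in q%:R * u'](Pdiv.IdomainMonic.divp_eq mp u').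
  by rewrite (_ : _ - _ = q%:R * p * (u' %/ p)) //; ring.
pose r := Ordinal (ltn_pmod (size (red q u)) d0).
have [Mg g0 szg] := gP r.
have leg : (size (red q (g r)) <= N)%N by apply: (leq_bigmax (F := fun i => size (red q (g i)))).
rewrite /= modn_mod in szg.
pose i := ((size (red q u) - size (red q (g r))) %/ d)%N.
have iE : size (red q u) = (size (red q (g r)) + i * d)%N.
  rewrite divnK ?subnKC //; first by rewrite ltnW // (leq_ltn_trans leg).
  rewrite -eqn_mod_dvd; first by rewrite szg.
  by rewrite ltnW // (leq_ltn_trans leg).
have f0 : red q f != 0 by rewrite -size_poly_gt0 szf.
pose y := f ^+ i * g r.
have My : M y.
  by rewrite /y; elim: (i) => [|j]; rewrite ?expr0 ?mul1r // exprS -mulrA; apply: Mf.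
have y0 : red q y != 0 by rewrite rmorphM rmorphXn /= mulf_neq0 ?expf_neq0.
have szy : size (red q u) = size (red q y).
  rewrite rmorphM rmorphXn /= size_mul ?expf_neq0 // iE.
  rewrite -[X in _ = (X + _).-1]prednK ?size_poly_gt0 ?expf_neq0 // size_exp szf /=.
  by rewrite mulnC addnC.
have [c cE] := lift_Fp (lead_coef (red q u) / lead_coef (red q y)).
have [|w [sw Mw]] := IH (u - c%:~R * y).
  rewrite ltnS in lts; apply: leq_trans lts; rewrite rmorphB rmorphM /= rmorph_int -(rmorph_int polyC) cE.
  exact: size_sub_lead.
exists w; split=> //; apply: (sub_diff sM (subMR sM c My)).
by rewrite addrAC.
Qed.

(** [J] is the largest ideal inside [M]. It contains [q^e] and some [f^i - f^j], which is nonzero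
    modulo [q] as [f] is nonconstant there. *)
Lemma stable_ideal M : stable M -> (forall r : 'I_d, hits M r) ->
  exists J, [/\ ideal J, fin_index J & forall u, J u -> M u].
Proof.
move=> stM hM; have [n nP] := stable_small stM hM; have [sM Mq Mp Mf] := stM.
have [T [cl clP]] : fin_index M.
  by apply: (@fin_index_small _ (q ^ e) n) => //; rewrite expn_gt0 prime_gt0.
pose J u := forall v, M (u * v).
have iJ : ideal J.
  split; first split.
  - by move=> v; rewrite mul0r; apply: sub0 sM.
  - by move=> u v Ju Jv x; rewrite mulrBl; apply: (subB sM).
  by move=> u v Jv x; rewrite -mulrA mulrCA; apply: Jv.
exists J; split=> //; last by move=> u Ju; rewrite -[u]mulr1.
(* The pigeonhole treats all [X^l] with [l < n] at once; these monomials span [Z[X]] modulo [M], and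
   [M] is stable under [f]. *)
have [i [j [ij /ffunP cij]]] :=
  not_injective_nat (fun i => [ffun l : 'I_n => cl (f ^+ i * 'X^l)]).
have Mfi i' u : M u -> M (f ^+ i' * u).
  by move=> Mu; elim: i' => [|l IH]; rewrite ?expr0 ?mul1r // exprS -mulrA; apply: Mf.
have f0 : red q f != 0 by rewrite -size_poly_gt0 szf.
apply: (@ideal_fin_index q e J (f ^+ i - f ^+ j)) => //.
  move=> v; have [r [sr Mr]] := nP v; apply: (sub_diff sM (v := (f ^+ i - f ^+ j) * r)).
    rewrite -[r]coefK poly_def mulr_sumr; apply: (sub_sum sM) => l _.
    rewrite -scalerAr -mul_polyC -[r`_l]intz (rmorph_int polyC); apply: (subMR sM).
    have ln : (l < n)%N by apply: leq_trans sr.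
    rewrite mulrBl; apply: clP.
    by have := cij (Ordinal ln); rewrite !ffunE.
  by rewrite -mulrBr mulrBl; apply: (subB sM); apply: Mfi.
rewrite rmorphB !rmorphXn /= subr_eq0; apply/eqP => /(congr1 (fun u : {poly 'F_q} => (size u).-1)).
by rewrite !size_exp szf /=; nia.
Qed.

End Extension.

(** * Separability from a square-free relation *)

Lemma separable_of_relation (I : {poly int} -> Prop) (k : nat) (p : {poly int}) :
  ideal I -> (0 < k)%N -> (forall q, prime q -> ~~ (q ^ 2 %| k)%N) ->
  p \is monic -> I (k%:R * p) -> poly_separable I.
Proof.
move=> [sI iI] k0 sqf mp Ikp A b sA IA starA nAb.
have [|m m0 nm] := subgroup_separated_mod sA mp _ k0 nAb.
  by move=> u; apply: IA; rewrite mulrC; apply: iI.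
have {m m0 nm} [q [e [q_pr nb]]] := separated_mod_prime_power sA m0 nm.
have iq := dvd_ideal (q ^ e).
pose B := setsum A (fun u => exists v, u = (q ^ e)%:R * v).
have sB : subgroup B by apply: setsum_subgroup => //; exact: iq.1.
have AB u : A u -> B u by apply: setsuml; exact: iq.1.
have Bq u : B ((q ^ e)%:R * u) by apply: setsumr => //; exists u.
(* As [k] is square-free, its gcd with [q^e] is 1 or [q]; hence [q] is an integral combination of
   [k] and [q^e]. *)
have Bp u : B (q%:R * p * u).
  have [x [y xy]] := Bezoutz k (q ^ e)%N.
  have /dvdzP [z zE] : (gcdz k (q ^ e)%N %| q%:Z)%Z.
    rewrite /gcdz dvdzE /=.
    have /(dvdn_pfactor _ _ q_pr) [n _ nE] : (gcdn k (q ^ e) %| q ^ e)%N by apply: dvdn_gcdr.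
    rewrite nE; case: n nE => [|[|n]] nE; rewrite ?dvd1n // ?expn1 //.
    case/negP: (sqf q q_pr); apply: dvdn_trans (dvdn_gcdl k (q ^ e)).
    by rewrite nE dvdn_exp2l.
  have qE : q%:R = z%:~R * (x%:~R * k%:R + y%:~R * (q ^ e)%:R) :> {poly int}.
    by rewrite [LHS]pmulrn zE -xy; ring.
  rewrite qE (_ : _ * u = (z * x)%:~R * (u * (k%:R * p)) + (q ^ e)%:R * (z%:~R * y%:~R * p * u)); last by ring.
  by apply: (subD sB) => //; apply: (subMR sB); apply/AB/IA/iI.
have starB := setsum_star iq starA.
have [zero|/existsNP [f0 /not_implyP [Bf0 f0n]]] := pselect (forall u, B u -> red q u = 0).
  (* Modulo [q], a failure of separation would give [b = X^L p v], which is too long unless [v]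
     vanishes; but then [X^L p v] is a multiple of [q p] and lies in [B]. *)
  pose L := size b.
  pose J0 := setsum (fun u => exists v, u = (q ^ e)%:R * v) (fun u => exists v, u = (q%:R * p) * v).
  have iJ0 : ideal J0 by apply: setsum_ideal => //; apply: principal_ideal.
  pose J := setsum J0 (fun u => exists v, u = ('X^L * p) * v).
  have iJ : ideal J by apply: setsum_ideal => //; apply: principal_ideal.
  have mXp : 'X^L * p \is monic by rewrite monicMl ?monicXn.
  exists J; split=> //.
    apply: (@ideal_fin_index q e J ('X^L * p)) => //.
    - apply: setsuml; first exact: (principal_ideal _).1.
      apply: setsuml; first exact: (principal_ideal _).1.
      by exists 1; rewrite mulr1.
    - by apply: setsumr; [exact: iJ0.1 | exists 1; rewrite mulr1].
    by rewrite -size_poly_gt0 size_red_monic // size_poly_gt0 monic_neq0.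
  case=> a [Aa [y [[y1 [[y2 y1E] [y3 yE]]] [v vE]]]].
  have By : B y.
    by rewrite -[y](subrK y1) yE y1E; apply: (subD sB).
  apply: nb; apply: (sub_diff sB (AB _ Aa)); apply: (sub_diff sB By); rewrite vE.
  have [v0|v0] := eqVneq (red q v) 0.
    have [v' ->] := red_eq0 q_pr v0.
    by rewrite (_ : _ * _ = q%:R * p * ('X^L * v')) //; ring.
  have : red q b = red q ('X^L * p * v).
    rewrite -vE !rmorphB /= (zero _ By) (zero _ (AB _ Aa)); ring.
  have r0 : red q ('X^L * p) != 0.
    by rewrite -size_poly_gt0 size_red_monic // size_poly_gt0 monic_neq0.
  have sXp : size ('X^L * p) = (L + size p)%N.
    by rewrite mulrC size_mulXn ?monic_neq0.
  move/(congr1 (fun u : {poly 'F_q} => size u)).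
  rewrite (rmorphM _ ('X^L * p)) size_mul // (size_red_monic q mXp) sXp => eb.
  have sv : (0 < size (red q v))%N by rewrite size_poly_gt0.
  have sp : (0 < size p)%N by rewrite size_poly_gt0 monic_neq0.
  suff : (size b < size (red q b))%N by rewrite ltnNge size_red.
  by rewrite eb -(prednK sv) addnS /= -(prednK sp) addnS addSn ltnS -addnA leq_addr.
(* The ring product with [f0] is multiplication by [X f0], which is nonconstant modulo [q] even when
   [f0] is a constant there. *)
have fs : red q ('X * f0) = 'X * red q f0 by rewrite rmorphM /= map_polyX.
move/eqP: f0n => f0n; have f0s : (0 < size (red q f0))%N by rewrite size_poly_gt0.
have szf : size (red q ('X * f0)) = (size (red q f0)).+1.
  by rewrite fs mulrC size_mulX.
have stB : stable q e p ('X * f0) B by split=> // u; apply: starB.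
have [M [stM BM nMb hM]] := stable_saturate q_pr mp szf f0s stB nb.
have [J [iJ fJ JM]] := stable_ideal q_pr mp szf f0s stM hM.
exists J; split=> // -[a [Aa Jb]]; apply: nMb.
have [sM _ _ _] := stM.
exact: (sub_diff sM (BM _ (AB _ Aa)) (JM _ Jb)).
Qed.

(** * Necessity *)

Definition is_square (n : nat) : bool := [exists i : 'I_n.+1, i * i == n]%N.

Lemma is_squareM s : is_square (s * s).
Proof.
have lt : (s < (s * s).+1)%N by rewrite ltnS; case: s => // s; rewrite leq_pmull.
by apply/existsP; exists (Ordinal lt).
Qed.

Lemma not_is_square s d : (0 < d)%N -> (d <= s)%N -> ~~ is_square (s * s + d).
Proof.
move=> d0 ds; apply/existsP => -[[i /= _] /eqP ie].
have [le|lt] := leqP i s; first by have := leq_mul le le; lia.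
have := leq_mul lt lt; rewrite mulSn mulnS; lia.
Qed.

(* The values on the 'X^l form a sequence that is not ultimately periodic. *)
Definition square_sum (h : {poly int}) : int :=
  \sum_(i < size h) h`_i * (is_square i)%:R.

Lemma square_sumE n (h : {poly int}) : (size h <= n)%N ->
  square_sum h = \sum_(i < n) h`_i * (is_square i)%:R.
Proof.
move=> hn; rewrite /square_sum (big_ord_widen n (fun i => h`_i * (is_square i)%:R) hn).
rewrite big_mkcond; apply: eq_bigr => i _; case: ltnP => // le.
by rewrite nth_default // mul0r.
Qed.

Lemma square_sumB u v : square_sum (u - v) = square_sum u - square_sum v.
Proof.
pose n := maxn (size u) (size v).
rewrite (square_sumE (leq_maxl _ _ : (size u <= n)%N)).
rewrite (square_sumE (leq_maxr _ _ : (size v <= n)%N)).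
rewrite (@square_sumE n); last by rewrite size_subr ?leq_maxl ?leq_maxr.
by rewrite -sumrB; apply: eq_bigr => i _; rewrite coefB mulrBl.
Qed.

Lemma square_sum0 : square_sum 0 = 0.
Proof. by rewrite /square_sum size_poly0 big_ord0. Qed.

Lemma square_sumMn m u : square_sum (m%:R * u) = m%:R * square_sum u.
Proof.
rewrite (square_sumE (size_natM u m)) /square_sum mulr_sumr.
by apply: eq_bigr => i _; rewrite coef_natM mulrA.
Qed.

Lemma square_sumXn l : square_sum 'X^l = (is_square l)%:R.
Proof.
rewrite /square_sum size_polyXn big_ord_recr /= coefXn eqxx mul1r big1 ?add0r // => i _.
by rewrite coefXn (ltn_eqF (ltn_ord i)) mul0r.
Qed.

(** By hypothesis [h] is determined modulo [q] by the class of [m P h], so [A] is the kernel of a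
    well-defined linear form modulo [q]. It is closed under products because each one brings a new
    factor [m], divisible by [q]. *)
Lemma null_obstruction (I : {poly int} -> Prop) (m q : nat) (P : {poly int}) :
  ideal I -> (1 < q)%N -> (q %| m)%N ->
  (forall h, I (m%:R * P * h) -> exists w, h = q%:R * w) -> ~ poly_separable I.
Proof.
move=> [sI iI] q1 qm hq sep.
pose A u := exists h, I (u - m%:R * P * h) /\ (q %| square_sum h)%Z.
have [||||J [[_ iJ] fJ nJ]] := sep A (m%:R * P).
- split; first by exists 0; rewrite mulr0 subr0 square_sum0 dvdz0; split=> //; exact: sub0.
  move=> u v [h [Iu qh]] [h' [Iv qh']]; exists (h - h'); split; last by rewrite square_sumB rpredB.
  rewrite (_ : _ - _ = (u - m%:R * P * h) - (v - m%:R * P * h')); last by ring.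
  exact: (subB sI).
- by move=> u Iu; exists 0; rewrite mulr0 subr0 square_sum0 dvdz0.
- move=> u v [h [Iu qh]] [h' [Iv qh']]; exists (m%:R * ('X * P * h * h')); split; last first.
    by rewrite square_sumMn dvdz_mulr // natz.
  rewrite (_ : _ - _ = ('X * v) * (u - m%:R * P * h) + ('X * m%:R * P * h) * (v - m%:R * P * h')); last by ring.
  by apply: (subD sI); apply: iI.
- move=> [h [Ih qh]].
  have [w wE] : exists w, 1 - h = q%:R * w by apply: hq; rewrite mulrBr mulr1.
  have : (q %| square_sum h + q%:R * square_sum w)%Z.
    by rewrite rpredD // dvdz_mulr // natz.
  have s1 : square_sum 1 = 1 by rewrite -(expr0 'X) square_sumXn (is_squareM 0).
  rewrite -square_sumMn -wE square_sumB s1 addrC subrK.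
  by rewrite dvdz1 /= => /eqP qe; rewrite qe in q1.
have [i [j [ij Jij]]] := fin_index_powers 'X fJ.
(* With [s = i + d], the square [l] is at least [i] and [l + d] is not a square. So [y] lies in [J]
   but has [square_sum] equal to 1, the same as the polynomial 1. *)
apply: nJ; pose d := (j - i)%N; pose s := (i + d)%N; pose l := (s * s)%N.
have il : (i <= l)%N.
  by rewrite /l (@leq_trans s) ?leq_addr //; case: (s) => // s'; rewrite leq_pmull.
have d0 : (0 < d)%N by rewrite subn_gt0.
pose y : {poly int} := 'X^l - 'X^(l + d).
have sy : square_sum y = 1.
  by rewrite square_sumB !square_sumXn is_squareM (negPf (not_is_square d0 _)) ?subr0 // leq_addl.
exists (m%:R * P * (1 - y)); split.
  exists (1 - y); rewrite subrr; split; first exact: sub0 sI.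
  rewrite square_sumB sy -(expr0 'X) square_sumXn (is_squareM 0).
  by rewrite (_ : _ - _ = 0) ?dvdz0.
rewrite (_ : _ - _ = m%:R * P * y); last by ring.
rewrite (_ : y = 'X^(l - i) * ('X^i - 'X^j)); first by do 2!apply: (iJ).
rewrite mulrBr -!exprD subnK //; congr (_ - 'X^_); rewrite /d; lia.
Qed.

(* Modulo q, P v has size at most N, so the coefficients of v beyond N are
   divisible by q and one factor q can be cancelled. *)
Lemma descent (q n : nat) (P : {poly int}) : prime q -> red q P != 0 ->
  size P = n.+1 -> forall K N (w r v : {poly int}),
  (q ^ K)%:R * w - r = P * v -> (size r <= N)%N ->
  exists r' v' : {poly int}, w - r' = P * v' /\ (size r' <= N + K * n)%N.
Proof.
move=> q_pr P0 sP; elim=> [|K IH] N w r v.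
  by rewrite mul1r => e sr; exists r, v; rewrite addn0.
move=> e sr.
have sv : (size (red q v) <= N)%N.
  have [->|v0] := eqVneq (red q v) 0; first by rewrite size_poly0.
  apply: leq_trans sr; apply: leq_trans (size_red q r).
  have -> : red q r = - (red q P * red q v).
    rewrite -rmorphM /= -e rmorphB /= expnS natrM -mulrA red_qM // sub0r opprK //.
  rewrite size_polyN size_mul // -[X in (X + _).-1]prednK ?size_poly_gt0 //.
  by rewrite addSn /= leq_addl.
have [v1 v1E] : exists v1, v - take_poly N v = q%:R * v1.
  apply: (red_eq0 q_pr); rewrite rmorphB; apply/polyP => i.
  rewrite coefB coef0 !coef_map /= coef_take_poly; case: ltnP => [_|le]; first by rewrite subrr.
  by rewrite rmorph0 subr0 -coef_map /= nth_default // (leq_trans sv).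
(* One factor [q] is cancelled; [q r1] is [r] plus [P] times the short part of [v], so the bound
   grows by the degree [n] of [P]. *)
pose r1 := (q ^ K)%:R * w - P * v1.
have qr1 : q%:R * r1 = r + P * take_poly N v.
  have -> : q%:R * r1 = ((q ^ K.+1)%:R * w - r) + r - P * (q%:R * v1).
    by rewrite /r1 expnS; ring.
  by rewrite e -v1E; ring.
have sr1 : (size r1 <= N + n)%N.
  have -> : size r1 = size (q%:R * r1).
    rewrite mulr_natl -scaler_nat size_scale // natz; have := prime_gt0 q_pr; lia.
  rewrite qr1 (leq_trans (size_polyD _ _)) // geq_max (leq_trans sr) ?leq_addr //=.
  rewrite (leq_trans (size_polyMleq _ _)) // sP addSn /= addnC leq_add2r size_take_poly //.
have [|r' [v' [wE sr']]] := IH (N + n)%N w r1 v1 _ sr1.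
  by rewrite /r1; ring.
by exists r', v'; split=> //; rewrite mulSn addnA.
Qed.

Lemma prime_part (c : int) q : prime q -> c != 0 ->
  exists s (c' : int), c = (q ^ s)%:Z * c' /\ coprimez q c'.
Proof.
move=> q_pr; rewrite -absz_gt0 => c0; have [m cop mE] := pfactor_coprime q_pr c0.
exists (logn q `|c|%N), ((-1) ^+ (c < 0)%R * m%:Z); split.
  by rewrite {1}(intEsign c) {1}mE PoszM mulrA mulrC.
by rewrite coprimezE abszM abszX /= exp1n mul1n.
Qed.

(** * Obstruction from a prime dividing the leading coefficient *)

Section Nonmonic.
Context (I : {poly int} -> Prop) (iI : ideal I) (P : {poly int}) (q : nat).
Context (q_pr : prime q) (IP : forall u, I u -> exists v, u = P * v).
Context (P0 : red q P != 0) (qP : (q %| lead_coef P)%Z).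

Let c : int := lead_coef P.
Let n := (size P).-1.

(* Corresponds to the subring Z<c a>: a polynomial in c X without constant term,
   divided by X, is c h(c X). *)
Definition integral_span (u : {poly int}) : Prop :=
  exists h v, u - c%:~R * (h \Po (c%:~R * 'X)) = P * v.

Lemma size_lead : size P = n.+1.
Proof.
rewrite prednK // size_poly_gt0; apply: contraNneq P0 => ->.
by rewrite rmorph0.
Qed.

Lemma lead_neq0 : c != 0.
Proof. by rewrite lead_coef_eq0 -size_poly_gt0 size_lead. Qed.

Lemma integral_span_subgroup : subgroup integral_span.
Proof.
split; first by exists 0, 0; rewrite comp_poly0 !mulr0 subrr.
move=> u v [h [w uE]] [h' [w' vE]]; exists (h - h'), (w - w').
by rewrite comp_polyB [in RHS]mulrBr -uE -vE; ring.
Qed.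

Lemma integral_span_principal v : integral_span (P * v).
Proof. by exists 0, v; rewrite comp_poly0 mulr0 subr0. Qed.

Lemma integral_span_star u v :
  integral_span u -> integral_span v -> integral_span ('X * u * v).
Proof.
move=> [h [w uE]] [h' [w' vE]]; exists ('X * h * h'), ('X * v * w + 'X * (c%:~R * (h \Po (c%:~R * 'X))) * w').
rewrite !comp_polyM comp_polyX.
transitivity ('X * v * (P * w) + 'X * (c%:~R * (h \Po (c%:~R * 'X))) * (P * w')); last by ring.
rewrite -uE -vE; ring.
Qed.

Lemma integral_span_Xn i : integral_span ((c ^+ i.+1)%:~R * 'X^i).
Proof.
exists 'X^i, 0; rewrite mulr0 comp_Xn_poly exprMn exprS rmorphM rmorphXn /=; ring.
Qed.

(** Horner evaluation: each multiplication by [c X] makes the possible coefficient in degree [n] a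
    multiple of [c], the leading coefficient of [P], and a multiple of [P] removes it. *)
Lemma integral_span_small u : integral_span u ->
  exists r v : {poly int}, (size r <= n)%N /\ u - r = P * v.
Proof.
case=> h [w uE].
suff [r [v [sr hE]]] : exists r v : {poly int}, (size r <= n)%N /\
    c%:~R * (h \Po (c%:~R * 'X)) - r = P * v.
  exists r, (w + v); split=> //; rewrite [in RHS]mulrDr -uE -hE; ring.
elim/poly_ind: h {u w uE} => [|h e [r [v [sr hE]]]].
  by exists 0, 0; rewrite comp_poly0 !mulr0 subrr size_poly0.
pose t := 'X * r + e%:P; pose r' := c%:~R * t - (t`_n)%:~R * P.
have st : (size t <= n.+1)%N.
  rewrite (leq_trans (size_polyD _ _)) // geq_max; apply/andP; split.
    by rewrite (leq_trans (size_polyMleq _ _)) // size_polyX.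
  exact: leq_trans (size_polyC_leq1 _) _.
exists r', (c%:~R * 'X * v + (t`_n)%:~R); split.
  apply: size_leq_pred.
    by rewrite size_subr // (leq_trans (size_intM _ _)) // size_lead.
  by rewrite coefB !coef_intM -[P`_n]lead_coefE mulrC subrr.
rewrite comp_polyD comp_polyM comp_polyX comp_polyC /r'.
transitivity (c%:~R * 'X * (P * v) + (t`_n)%:~R * P); last by ring.
by rewrite -hE; move: (t`_n) => a; rewrite /t; ring.
Qed.

Lemma nonmonic_obstruction : ~ poly_separable I.
Proof.
move=> sep; have [s [c' [cE cop]]] := prime_part q_pr lead_neq0.
(* [K] is large enough for [q^K] to absorb [q^(s(i+1))] for all [i < n]; [j] is the size bound given
   by [descent], so [w], of degree [j], keeps its leading term. *)
pose K := (s * n)%N; pose j := (n + K * n)%N.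
pose w : {poly int} := (c' ^+ j.+1)%:~R * 'X^j.
have sA := integral_span_subgroup.
have c'0 : c' != 0 by apply: contraNneq lead_neq0 => c'0; rewrite cE c'0 mulr0.
have coe i k : exists x y : int, x * c' ^+ i + y * (q ^ k)%N = 1.
  have /coprimezP [[x y] /= xy] : coprimez (c' ^+ i) (q ^ k)%N.
    move: cop; rewrite !coprimezE abszX /= => cop; rewrite coprime_sym.
    exact: coprimeXl (coprimeXr _ cop).
  by exists x, y.
have [|||J [iJ fJ nJ]] := sep integral_span ((q ^ K)%:R * w) sA.
- by move=> u /IP [v ->]; apply: integral_span_principal.
- exact: integral_span_star.
- move=> /integral_span_small [r [v [sr e]]].
  have [r' [v' [e' sr']]] := descent q_pr P0 size_lead e sr.
  have : lead_coef (w - r') = c' ^+ j.+1.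
    have sw : size w = j.+1.
      rewrite /w -(rmorph_int polyC) mul_polyC size_scale ?size_polyXn //.
      by rewrite intz expf_neq0.
    rewrite lead_coefDl ?size_polyN ?sw ?ltnS //.
    by rewrite /w -(rmorph_int polyC) lead_coefM lead_coefC lead_coefXn mulr1 intz.
  (* The leading coefficient [c'^(j+1)] would be divisible by that of [P], hence by [q], although
     [c'] is prime to [q]. *)
  rewrite e' lead_coefM => leadE.
  have [x [y xy]] := coe j.+1 1%N.
  have : (q %| x * c' ^+ j.+1 + y * (q ^ 1)%N)%Z.
    apply: rpredD; first by rewrite -leadE; apply: dvdz_mull; apply: dvdz_mulr.
    by rewrite expn1; apply: dvdz_mull.
  by rewrite xy dvdz1 /= => /eqP q1; have := q_pr; rewrite q1.
apply: nJ; pose B := setsum integral_span J.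
have sB : subgroup B by apply: setsum_subgroup => //; exact: iJ.1.
have AB u : integral_span u -> B u by apply: setsuml; exact: iJ.1.
(* The quotient is killed by [m = m' q^e]. The multiples of the element by [q^e] and by [m'] are
   shown to lie in [B] separately, then combined by Bezout. *)
have [m m0 Jm] := fin_index_natr iJ.1 fJ.
have Bm u : B (m%:R * u) by apply: setsumr => //; rewrite mulrC; apply: iJ.2.
have [m' cop' mE] := pfactor_coprime q_pr m0; set e := logn q m in mE.
have mR : m%:R = m'%:R * (q ^ e)%:R :> {poly int} by rewrite mE natrM.
have cR : c%:~R = (q ^ s)%:R * c'%:~R :> {poly int} by rewrite cE rmorphM.
have BX i := AB _ (integral_span_Xn i).
(* Prime to q, the part q^s of c is invertible and q^s (c' X) = c X. *)
have Bqe : B ((q ^ e)%:R * ((q ^ K)%:R * w)).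
  have /coprimezP [[x y] /= xy] : coprimez (q ^ (s * j.+1))%N m'.
    by rewrite coprimezE /= coprimeXl.
  have xyR : x%:~R * (q ^ (s * j.+1))%:R + y%:~R * m'%:R = 1 :> {poly int}.
    by rewrite [RHS](_ : _ = 1%:~R) // -xy; ring.
  rewrite (_ : _ * _ = (x%:~R * ((q ^ e)%:R * ((q ^ K)%:R * ((c ^+ j.+1)%:~R * 'X^j))))
     + m%:R * (y%:~R * (q ^ K)%:R * w)).
    apply: (subD sB) => //; apply: (subMR sB); do 2!apply: (subMRn sB).
    exact: BX.
  rewrite -[LHS]mul1r -[X in X * _ = _]xyR mR /w !rmorphXn /= cR rmorphXn /= exprMn exprM; ring.
(* On the q-primary part, powers of X reduce to degree < n and c' is invertible. *)
have Bm' : B (m'%:R * ((q ^ K)%:R * w)).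
  pose J' := setsum (fun u => exists v, u = P * v) J.
  have iJ' : ideal J' by apply: setsum_ideal => //; apply: principal_ideal.
  have J'B u : J' u -> B u.
    by case=> x [[v ->] Jx]; exists (P * v); split=> //; apply: integral_span_principal.
  have J'P : J' P by apply: setsuml; [exact: iJ.1 | exists 1; rewrite mulr1].
  have [r [u' [sr Jw]]] := mod_reduce q_pr iJ' J'P P0 e w.
  rewrite (_ : _ * _ = m'%:R * (q ^ K)%:R * (w - r - (q ^ e)%:R * u')
     + m%:R * ((q ^ K)%:R * u') + m'%:R * ((q ^ K)%:R * r)); last by rewrite mR; ring.
  have rn : (size r <= n)%N.
    apply: leq_trans sr _; rewrite -ltnS -size_lead.
    rewrite prednK ?size_poly_gt0 //; exact: size_red.
  apply: (subD sB); first by apply: (subD sB) => //; apply: J'B; apply: iJ'.2.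
  rewrite -[r]coefK poly_def !mulr_sumr; apply: (sub_sum sB) => i _.
  have lin : (i < n)%N by apply: leq_trans rn.
  rewrite -mul_polyC -[r`_i]intz (rmorph_int polyC).
  rewrite (_ : _ * _ = (r`_i)%:~R * (m'%:R * ((q ^ K)%:R * 'X^i))); last by ring.
  apply: (subMR sB); have [x [y xy]] := coe i.+1 e.
  have xyR : x%:~R * (c' ^+ i.+1)%:~R + y%:~R * (q ^ e)%:R = 1 :> {poly int}.
    by rewrite [RHS](_ : _ = 1%:~R) // -xy; ring.
  have le : (s * i.+1 <= K)%N by rewrite leq_mul2l lin orbT.
  rewrite (_ : _ * _ = x%:~R * (m'%:R * ((q ^ (K - s * i.+1))%:R * ((c ^+ i.+1)%:~R * 'X^i)))
    + m%:R * (y%:~R * (q ^ K)%:R * 'X^i)).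
    by apply: (subD sB) => //; apply: (subMR sB); do 2!apply: (subMRn sB); apply: BX.
  have KE : q%:R ^+ K = (q%:R ^+ s) ^+ i.+1 * q%:R ^+ (K - s * i.+1) :> {poly int}.
    by rewrite -exprM -exprD subnKC.
  rewrite -[LHS]mul1r -[X in X * _ = _]xyR mR !rmorphXn /= cR rmorphXn /= exprMn KE; ring.
have /coprimezP [[x y] /= xy] : coprimez m' (q ^ e)%N.
  by rewrite coprimezE /= coprimeXr // coprime_sym.
have xyR : x%:~R * m'%:R + y%:~R * (q ^ e)%:R = 1 :> {poly int}.
  by rewrite [RHS](_ : _ = 1%:~R) // -xy; ring.
rewrite (_ : _ * w = x%:~R * (m'%:R * ((q ^ K)%:R * w)) + y%:~R * ((q ^ e)%:R * ((q ^ K)%:R * w))).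
  by apply: (subD sB); apply: (subMR sB).
by rewrite !mulrA -mulrDl -mulrA -[LHS]mul1r -[X in X * _ = _]xyR; ring.
Qed.

End Nonmonic.

(** * From separability to a square-free relation *)

Lemma relation_of_separable (I : {poly int} -> Prop) : ideal I -> poly_separable I ->
  exists k p, [/\ (0 < k)%N, forall q, prime q -> ~~ (q ^ 2 %| k)%N,
    p \is monic & I (k%:R * p)].
Proof.
move=> iI sep; have [sI mI] := iI.
have [g0 [Ig0 g0n]] : exists u, I u /\ u != 0.
  apply: contrapT => nI; apply: (@null_obstruction I 2 2 1) sep => // h Ih.
  exists 0; rewrite mulr0; apply: contrapT => /eqP h0; apply: nI.
  by exists (2%:R * 1 * h); split=> //; rewrite mulr1 mulf_neq0 // -(rmorph_nat polyC) polyC_eq0.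
pose S n := `[< exists u : {poly int}, [/\ I u, u != 0 & size u = n] >].
have exS : exists n, S n by exists (size g0); apply/asboolP; exists g0.
have [n /asboolP [g [Ig gn sg]] nmin] := ex_minnP exS.
pose P := zprimitive g.
(* Pseudo-division leaves a remainder in [I] of smaller size than [g], hence zero; by Gauss's lemma
   rational divisibility by [g] becomes integral divisibility by its primitive part. *)
have IP u : I u -> exists v, u = P * v.
  move=> Iu; suff gu : g %| u by have [v ->] := dvdpP_int gu; exists v.
  apply: contrapT; rewrite /dvdp => /negP r0.
  have := nmin (size (u %% g)); rewrite -sg leqNgt ltn_modp gn => /(_ _)/negP; apply => //.
  apply/asboolP; exists (u %% g); split=> //.
  have -> : u %% g = (lead_coef g ^+ scalp u g)%:~R * u - (u %/ g) * g.
    rewrite -(rmorph_int polyC) mul_polyC intz Pdiv.Idomain.divp_eq addrC addKr //.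
  by apply: (subB sI); [apply: (subMR sI) | apply: mI].
have gE : g = (zcontents g)%:~R * P.
  by rewrite -(rmorph_int polyC) mul_polyC intz -zpolyEprim.
have Pn : P != 0 by apply: contraNneq gn => P0; rewrite gE P0 mulr0.
have lead1 : absz (lead_coef P) = 1%N.
  apply/eqP; apply: contrapT => /negP l1.
  have l2 : (1 < absz (lead_coef P))%N.
    by move: l1; have := lead_coef_eq0 P; rewrite (negPf Pn); lia.
  have q_pr := pdiv_prime l2; set q := pdiv _ in q_pr.
  apply: (@nonmonic_obstruction I P q) sep => //; last by rewrite dvdzE /= pdiv_dvd.
  apply/eqP => /(red_eq0 q_pr) [v vE].
  have : (q %| zcontents P)%Z.
    rewrite dvdz_contents; apply/polyOverP => i.
    by rewrite vE coef_natM natz; apply: dvdz_mulr.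
  by rewrite zcontents_primitive gn dvdz1 /= => /eqP q1; rewrite q1 in q_pr.
(* The least [k] is square-free: if [q^2] divides it and [(k/q) p h] is in [I] with [h] nonzero
   modulo [q], a monic lift of [h] gives a relation with the smaller multiplier [k/q]. So
   [null_obstruction] applies with [m = k/q]. *)
pose T k := (0 < k)%N && `[< exists2 p, p \is monic & I (k%:R * p) >].
have exT : exists k, T k.
  exists (absz (zcontents g)); rewrite /T absz_gt0 zcontents_eq0 gn /=; apply/asboolP.
  exists ((lead_coef P)%:~R * P).
    rewrite monicE -(rmorph_int polyC) lead_coefM lead_coefC intz.
    by have [->|->] : lead_coef P = 1 \/ lead_coef P = -1 by lia.
  rewrite (_ : _%:R * (_ * _) = ((-1) ^+ (zcontents g < 0)%R * lead_coef P)%:~R * g); first exact: (subMR sI _ Ig).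
  transitivity (((-1) ^+ (zcontents g < 0)%R * lead_coef P)%:~R *
    ((zcontents g)%:~R * P)); last by rewrite -gE.
  rewrite pmulrn abszEsign; move: (zcontents g) => z; move: ((-1) ^+ _) => sg'; ring.
have [k /andP [k0 /asboolP [p mp Ikp]] kmin] := ex_minnP exT.
exists k, p; split=> // q q_pr; apply/negP => q2k.
have qk : (q %| k)%N by apply: dvdn_trans q2k; rewrite dvdn_exp.
have kE : k%:R = (k %/ q)%:R * q%:R :> {poly int} by rewrite -natrM divnK.
apply: (@null_obstruction I (k %/ q) q p) sep => //; first exact: prime_gt1.
  by rewrite dvdn_divRL // mulnn.
move=> h Ih; apply: (red_eq0 q_pr); apply/eqP; apply: contrapT => /negP h0.
have [w [e /= [mh _]]] := monic_lift q_pr h0.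
have := kmin (k %/ q)%N; rewrite leqNgt ltn_Pdiv ?prime_gt1 // => /(_ _)/negP; apply => //.
rewrite /T divn_gt0 ?prime_gt0 // dvdn_leq //=; apply/asboolP.
exists (p * (w%:~R * h - q%:R * e)); first by rewrite monicMl.
rewrite (_ : _%:R * (p * _) = w%:~R * ((k %/ q)%:R * p * h) - e * (k%:R * p)); last by rewrite kE; ring.
by apply: (subB sI); [apply: (subMR sI) | apply: mI].
Qed.

Lemma dvdn_prime_prod q (s : seq nat) : prime q -> all prime s ->
  (q %| \prod_(p <- s) p)%N -> q \in s.
Proof.
move=> q_pr; elim: s => [_|p s IH /= /andP [p_pr s_pr]].
  by rewrite big_nil dvdn1 => /eqP q1; rewrite q1 in q_pr.
rewrite big_cons Euclid_dvdM // inE dvdn_prime2 // => /orP [->//|qs].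
by rewrite IH ?orbT.
Qed.

Lemma squarefreeP k : (0 < k)%N ->
  squarefree k <-> forall q, prime q -> ~~ (q ^ 2 %| k)%N.
Proof.
move=> k0; split=> [[s [us [s_pr kE]]] q q_pr|sqf].
  apply/negP; rewrite kE => q2.
  have qs : q \in s.
    by apply: dvdn_prime_prod => //; apply: dvdn_trans q2; rewrite dvdn_exp.
  move: q2; rewrite (big_rem q qs) /= -mulnn dvdn_pmul2l ?prime_gt0 // => qr.
  have : q \in rem q s.
    apply: dvdn_prime_prod qr => //; apply/allP => x /mem_rem; exact/allP.
  by rewrite mem_rem_uniq // inE eqxx.
exists (primes k); split; first exact: primes_uniq.
split; first by apply/allP => p; rewrite mem_primes => /andP [].
rewrite [LHS]prod_prime_decomp // prime_decompE big_map /= big_seq [RHS]big_seq.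
apply: eq_bigr => p; rewrite mem_primes => /and3P [p_pr _ pk].
have := sqf p p_pr; rewrite pfactor_dvdn // -ltnNge ltnS => le1.
have : (0 < logn p k)%N by rewrite logn_gt0 mem_primes p_pr k0.
by case: (logn p k) le1 => [|[|]] //; rewrite expn1.
Qed.

Theorem theorem1 (V : zmodType) (mul : V -> V -> V) (HK : is_ring mul) (a : V) :
  fin_separable_sub mul (Zgen mul a) <->
  exists (k n : nat) (kc : nat -> int),
    (0 < k)%N /\ squarefree k /\ (0 < n)%N /\
    (apow mul a n + \sum_(1 <= j < n) apow mul a (n - j) *~ kc j) *+ k = 0.
Proof.
have psiMR k p : psi mul a (k%:R * p) = psi mul a p *+ k.
  by rewrite mulr_natl psiMn.
rewrite fin_separable_subE //; split.
  move=> /(relation_of_separable (ker_ideal HK a)) [k [p [k0 sqf mp]]].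
  rewrite psiMR psi_monicE // => rel.
  exists k, (size p), (fun j => p`_((size p).-1 - j)); split=> //; split.
    exact/squarefreeP.
  by rewrite size_poly_gt0 monic_neq0.
case=> k [n [kc [k0 [sqf [n0]]]]].
have [p mp <-] := psi_monic mul a kc n0; rewrite -psiMR => rel.
by apply: (separable_of_relation (ker_ideal HK a) k0 _ mp rel); apply/squarefreeP.
Qed.
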